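(* Let $D^k$ ($k\ge 0$) be the natural transformations defined recursively in the context. Let $V_\bullet, W_\bullet$ be simplicial $\mathbb{F}_2$-vector spaces, and let $i,j,k\ge0$ be integers with $i+j\ge 2k$. Then, as natural transformations $V_i\otimes W_j\to V_{i+j-k}\otimes W_{i+j-k}$, $$D^0+TD^0T=D+\phi_0\qquad\text{if } k=0,$$ $$D^k+TD^kT=D^{k-1}\partial+\partial D^{k-1}+\phi_k\qquad\text{if } k\ge1.$$
   Context: All tensor products are over $\mathbb{F}_2$. **Suspension.** For a simplicial $\mathbb{F}_2$-vector space $V_\bullet$, let $\mathcal{S}V$ be the simplicial vector space with $(\mathcal{S}V)_n=V_{n+1}$, whose face and degeneracy operators $d_r,s_r$ are the operators $d_{r+1},s_{r+1}$ of $V$. If $\theta_{V,W}\colon V_i\otimes W_j\to V_k\otimes W_l$ is a transformation natural in $V_\bullet,W_\bullet$, its suspension is the natural transformation $\mathcal{S}(\theta)_{V,W}=\theta_{\mathcal{S}V,\mathcal{S}W}\colon V_{i+1}\otimes W_{j+1}\to V_{k+1}\otimes W_{l+1}$. (So on expressions in the generators, $\mathcal{S}$ raises every index of $d_r$ and $s_r$ by one.) **Eilenberg–MacLane map.** For $i,j\ge0$, $$D_{i,j}=\sum s_{\nu_j}\cdots s_{\nu_1}\otimes s_{\mu_i}\cdots s_{\mu_1}\colon V_i\otimes W_j\to V_{i+j}\otimes W_{i+j},$$ the sum being over all $(i,j)$-shuffles, i.e. pairs of increasing sequences $\mu_1<\dots<\mu_i$ and $\nu_1<\dots<\nu_j$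 in which each element of $\{0,1,\dots,i+j-1\}$ occurs exactly once. **Definition of $D^k$.** $D^k_{i,j}\colon V_i\otimes W_j\to V_{i+j-k}\otimes W_{i+j-k}$ is the natural transformation given, for $i,j\ge0$ with $i+j\ge2k$, by: - $D^0_{i,j}=\mathcal{S}(D_{i-1,j})\circ(\mathrm{id}\otimes s_0)$ if $i\ge1$, and $D^0_{0,j}=0$; - for $k\ge1$: $$D^k_{i,j}=\begin{cases}\mathcal{S}(D^{k-1}_{i-1,j-1})+D^{k-1}_{i-1,j}(d_0\otimes\mathrm{id}) & k\text{ even},\ i,j\ge1,\\ \mathcal{S}(D^{k-1}_{i-1,j-1})+D^{k-1}_{i,j-1}(\mathrm{id}\otimes d_0) & k\text{ odd},\ i,j\ge1,\\ D^{k-1}_{i-1,j}(d_0\otimes\mathrm{id}) & k\text{ even},\ i\ge1,\ j=0,\\ D^{k-1}_{i,j-1}(\mathrm{id}\otimes d_0) & k\text{ odd},\ i=0,\ j\ge1,\\ 0&\text{otherwise.}\end{cases}$$ **Other notation.** $\phi_k\colon V_i\otimes W_j\to V_{i+j-k}\otimes W_{i+j-k}$ is the identity if $i=j=k$ and zero otherwise. $T$ is the interchange of tensor factors, and $TD^kT$ on $V_i\otimes W_j$ is the composite $V_i\otimes W_j\to W_j\otimes V_i\to W_{i+j-k}\otimes V_{i+j-k}\to V_{i+j-k}\otimes W_{i+j-k}$ whose middle map is $D^k_{j,i}$ for the pair $(W,V)$. In $D^{k-1}\partial$, $\partial$ is the tensor product differential $\partial\otimes\mathrm{id}+\mathrm{id}\otimes\partial$,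 where $\partial=\sum_{r=0}^n d_r$ on $V_n$ or $W_n$ for $n\ge1$ and $\partial=0$ in degree $0$; thus $D^{k-1}\partial=D^{k-1}_{i-1,j}(\partial\otimes\mathrm{id})+D^{k-1}_{i,j-1}(\mathrm{id}\otimes\partial)$, where a term with a negative index is zero. In $\partial D^{k-1}$, $\partial=\sum_{r=0}^{n}d_r\otimes d_r\colon V_n\otimes W_n\to V_{n-1}\otimes W_{n-1}$ with $n=i+j-k+1$. *)

(* Defs.v *)
From HB Require Import structures.
From mathcomp Require Import all_boot all_order all_algebra generic_quotient.
From mathcomp Require Import ring_quotient sesquilinear.
From mathcomp Require Import boolp.
From mathcomp.multinomials Require Import freeg.
(* Restores [lift] on ordinals, shadowed by freeg. *)
From mathcomp Require Import fintype.

Set Implicit Arguments.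
Unset Strict Implicit.
Unset Printing Implicit Defensive.

Import GRing.Theory Quotient.
Local Open Scope quotient_scope.
Local Open Scope ring_scope.

Section LinearMaps.
Variables (R : nzRingType) (U V : lmodType R).

Definition lin_sum (I : finType) (P : pred I) (F : I -> {linear U -> V}) (x : U)
  : V := \sum_(r | P r) F r x.

Lemma lin_sum_is_linear (I : finType) (P : pred I) (F : I -> {linear U -> V}) :
  linear (lin_sum P F).
Proof.
move=> a x y; rewrite /lin_sum scaler_sumr -big_split /=.
by apply: eq_bigr => r _; rewrite linearP.
Qed.
HB.instance Definition _ I P F :=
  GRing.isLinear.Build R U V *:%R (@lin_sum I P F) (lin_sum_is_linear P F).

End LinearMaps.

Section FreeLift.
Variables (R : nzRingType) (K : choiceType) (M : lmodType R) (f : K -> M).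

Lemma fglift_is_linear : linear (fglift f : {freeg K / R} -> M).
Proof.
have fgD (x y : {freeg K / R}) : fglift f (x + y) = fglift f x + fglift f y.
  have fB := lift_is_additive f.
  have f0 : fglift f 0 = 0 by rewrite -(subrr (0 : {freeg K / R})) fB subrr.
  have fN z : fglift f (- z) = - fglift f z by rewrite -[- z]add0r fB f0 sub0r.
  by rewrite -[y in LHS]opprK fB fN opprK.
have f0 : fglift f 0 = 0.
  by apply: (addrI (fglift f 0)); rewrite -fgD !addr0.
move=> a x y; rewrite fgD; congr (_ + _).
rewrite -{2}[x]freeg_sumE /(a *: x) /= /fgscale.
rewrite !(big_morph _ fgD f0) scaler_sumr; apply: eq_bigr => z _.
by rewrite !liftU scalerA.
Qed.
HB.instance Definition _ :=
  GRing.isLinear.Build R {freeg K / R} M *:%R (fglift f) fglift_is_linear.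

End FreeLift.

Section Tensor.
Variables (R : comNzRingType) (U V : lmodType R).

(* The tensor product is the free module on pairs modulo the submodule
   spanned by the bilinearity relations. *)
Inductive tensor_rel : {freeg (U * V) / R} -> Prop :=
| Trel0 : tensor_rel 0
| TrelP a x y : tensor_rel x -> tensor_rel y -> tensor_rel (a *: x + y)
| Trell a u u' v :
    tensor_rel (<< (a *: u + u', v) >> - (a *: << (u, v) >> + << (u', v) >>))
| Trelr a u v v' :
    tensor_rel (<< (u, a *: v + v') >> - (a *: << (u, v) >> + << (u, v') >>)).

Definition tensor_null : {pred {freeg (U * V) / R}} := fun x => `[< tensor_rel x >].

Lemma tensor_null_zmod_closed : zmod_closed tensor_null.
Proof.
split=> [|x y /asboolP xN /asboolP yN]; first exact/asboolP/Trel0.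
by apply/asboolP; rewrite addrC -scaleN1r; apply: TrelP.
Qed.
HB.instance Definition _ :=
  GRing.isZmodClosed.Build {freeg (U * V) / R} tensor_null
    tensor_null_zmod_closed.

Lemma tensor_nullZ a x : x \in tensor_null -> a *: x \in tensor_null.
Proof.
move=> /asboolP xN; apply/asboolP; rewrite -[_ *: _]addr0.
by apply: TrelP => //; apply: Trel0.
Qed.

Definition tensor_sub : zmodClosed {freeg (U * V) / R} := tensor_null.
Definition tensor : Type := {quot tensor_sub}.

HB.instance Definition _ := GRing.Zmodule.on tensor.

Definition tensor_pi (x : {freeg (U * V) / R}) : tensor :=
  \pi_({quot tensor_sub}) x.

Lemma tensor_piE x y : (tensor_pi x == tensor_pi y) = (x - y \in tensor_null).
Proof. by rewrite /tensor_pi -idealrBE. Qed.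

Lemma tensor_piD x y : tensor_pi (x + y) = tensor_pi x + tensor_pi y.
Proof. by rewrite /tensor_pi raddfD. Qed.

Lemma tensor_piW (P : tensor -> Prop) : (forall x, P (tensor_pi x)) -> forall t, P t.
Proof. by move=> Ppi; elim/quotW => x; apply: Ppi. Qed.

Definition tensor_scale (a : R) (t : tensor) : tensor :=
  tensor_pi (a *: (repr t : {freeg (U * V) / R})).

Lemma tensor_piZ a x : tensor_scale a (tensor_pi x) = tensor_pi (a *: x).
Proof.
apply/eqP; rewrite tensor_piE -scalerBr; apply: tensor_nullZ.
by rewrite -tensor_piE /tensor_pi reprK.
Qed.

Lemma tensor_scaleA a b t :
  tensor_scale a (tensor_scale b t) = tensor_scale (a * b) t.
Proof. by elim/tensor_piW: t => x; rewrite !tensor_piZ scalerA. Qed.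

Lemma tensor_scale1 : left_id 1 tensor_scale.
Proof. by elim/tensor_piW => x; rewrite tensor_piZ scale1r. Qed.

Lemma tensor_scaleDr : right_distributive tensor_scale +%R.
Proof.
move=> a; elim/tensor_piW => x; elim/tensor_piW => y.
by rewrite -tensor_piD !tensor_piZ -tensor_piD scalerDr.
Qed.

Lemma tensor_scaleDl t : {morph tensor_scale^~ t : a b / a + b}.
Proof.
by elim/tensor_piW: t => x a b; rewrite !tensor_piZ -tensor_piD scalerDl.
Qed.

HB.instance Definition _ := GRing.Zmodule_isLmodule.Build R tensor
  tensor_scaleA tensor_scale1 tensor_scaleDr tensor_scaleDl.

Lemma tensor_pi_is_linear : linear tensor_pi.
Proof. by move=> a x y; rewrite tensor_piD -tensor_piZ. Qed.
HB.instance Definition _ :=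
  GRing.isLinear.Build R _ tensor *:%R tensor_pi tensor_pi_is_linear.

Definition tmul (u : U) (v : V) : tensor := tensor_pi << (u, v) >>.

Lemma tmul_is_bilinear : bilinear_for *:%R *:%R tmul.
Proof.
split=> [v a u u'|u a v v']; rewrite /tmul -linearP; apply/eqP;
  rewrite tensor_piE; apply/asboolP; [exact: Trell | exact: Trelr].
Qed.
HB.instance Definition _ :=
  bilinear_isBilinear.Build R U V tensor *:%R *:%R tmul tmul_is_bilinear.

Lemma tensor_sumP (t : tensor) :
  exists s : seq (R * (U * V)), t = \sum_(x <- s) x.1 *: tmul x.2.1 x.2.2.
Proof.
elim/tensor_piW: t => x; exists [seq (coeff z x, z) | z <- dom x].
rewrite big_map -[x in LHS]freeg_sumE linear_sum; apply: eq_bigr => -[u v] _ /=.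
rewrite /tmul -linearZ; congr tensor_pi; apply/eqP/freeg_eqP => z.
by rewrite coeffZ !coeffU mul1r.
Qed.

Lemma tensor_ext (M : lmodType R) (f g : {linear tensor -> M}) :
  (forall u v, f (tmul u v) = g (tmul u v)) -> f =1 g.
Proof.
move=> fg t; have [s ->] := tensor_sumP t; rewrite !linear_sum.
by apply: eq_bigr => x _; rewrite !linearZ /= fg.
Qed.

Section Lift.
Variables (M : lmodType R) (f : {bilinear U -> V -> M}).

Let f2 (x : U * V) : M := f x.1 x.2.

Definition tlift (t : tensor) : M := fglift f2 (repr t : {freeg (U * V) / R}).

Lemma fglift_null x : x \in tensor_null -> fglift f2 x = 0.
Proof.
move=> /asboolP; elim=> [|a {}x y _ x0 _ y0|a u u' v|a u v v'].
- exact: linear0.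
- by rewrite linearP /= x0 y0 scaler0 addr0.
- rewrite linearB linearP /= !liftU !scale1r /f2 /=.
  by rewrite linearPl /= subrr.
- rewrite linearB linearP /= !liftU !scale1r /f2 /=.
  by rewrite linearPr /= subrr.
Qed.

Lemma tlift_pi x : tlift (tensor_pi x) = fglift f2 x.
Proof.
apply/eqP; rewrite -subr_eq0 /tlift -linearB /= fglift_null //.
by rewrite -tensor_piE /tensor_pi reprK.
Qed.

Lemma tlift_is_linear : linear tlift.
Proof.
move=> a; elim/tensor_piW => x; elim/tensor_piW => y.
by rewrite -linearP !tlift_pi linearP.
Qed.
HB.instance Definition _ :=
  GRing.isLinear.Build R tensor M *:%R tlift tlift_is_linear.

Lemma tlift_tmul u v : tlift (tmul u v) = f u v.
Proof. by rewrite tlift_pi liftU scale1r. Qed.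

End Lift.

End Tensor.

Arguments tmul {R U V} u v.

Notation "U ⊗ V" := (tensor U V) (at level 40, left associativity) : type_scope.

Section TensorMaps.
Variables (R : comNzRingType) (U U' V V' : lmodType R).

Section Map.
Variables (f : {linear U -> U'}) (g : {linear V -> V'}).

Definition tmap_pre (u : U) (v : V) : U' ⊗ V' := tmul (f u) (g v).

Lemma tmap_pre_is_bilinear : bilinear_for *:%R *:%R tmap_pre.
Proof.
split=> [v a u u'|u a v v']; rewrite /tmap_pre linearP.
  by rewrite linearPl.
by rewrite linearPr.
Qed.
HB.instance Definition _ :=
  bilinear_isBilinear.Build R U V (U' ⊗ V')%type *:%R *:%R tmap_pre
    tmap_pre_is_bilinear.

(* [f ⊗ g], characterised by [tmap_tmul]. *)
Definition tmap : {linear U ⊗ V -> U' ⊗ V'} := tlift tmap_pre.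

Lemma tmap_tmul u v : tmap (tmul u v) = tmul (f u) (g v).
Proof. exact: tlift_tmul. Qed.

End Map.

Definition tswap_pre (u : U) (v : V) : V ⊗ U := tmul v u.

Lemma tswap_pre_is_bilinear : bilinear_for *:%R *:%R tswap_pre.
Proof.
split=> [v a u u'|u a v v']; rewrite /tswap_pre; first by rewrite linearPr.
by rewrite linearPl.
Qed.
HB.instance Definition _ :=
  bilinear_isBilinear.Build R U V (V ⊗ U)%type *:%R *:%R tswap_pre
    tswap_pre_is_bilinear.

Definition tswap : {linear U ⊗ V -> V ⊗ U} := tlift tswap_pre.

Lemma tswap_tmul u v : tswap (tmul u v) = tmul v u.
Proof. exact: tlift_tmul. Qed.

End TensorMaps.

Arguments tswap {R U V}.

Record simplicial := Simplicial {
  sobj :> nat -> lmodType 'F_2;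
  face : forall n, 'I_n.+2 -> {linear sobj n.+1 -> sobj n};
  degen : forall n, 'I_n.+1 -> {linear sobj n -> sobj n.+1};
  (* The index [widen_ord (leqnSn _) r] has the value of [r], and [lift ord0 r]
     has the value [r + 1]. *)
  face_face : forall n (p q : 'I_n.+2) x, (p <= q)%N ->
    face p (face (lift ord0 q) x) =
    face q (face (widen_ord (leqnSn _) p) x);
  degen_degen : forall n (p q : 'I_n.+1) x, (p <= q)%N ->
    degen (widen_ord (leqnSn _) p) (degen q x) =
    degen (lift ord0 q) (degen p x);
  face_degen_lt : forall n (p : 'I_n.+2) (q : 'I_n.+1) x, (p <= q)%N ->
    face (widen_ord (leqnSn _) p) (degen (lift ord0 q) x) =
    degen q (face p x);
  face_degen_id : forall n (q : 'I_n.+1) x,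
    face (widen_ord (leqnSn _) q) (degen q x) = x;
  face_degen_idS : forall n (q : 'I_n.+1) x,
    face (lift ord0 q) (degen q x) = x;
  face_degen_gt : forall n (p : 'I_n.+2) (q : 'I_n.+1) x, (q < p)%N ->
    face (lift ord0 p) (degen (widen_ord (leqnSn _) q) x) =
    degen q (face p x)
}.

Arguments face V n r : clear implicits, rename.
Arguments degen V n r : clear implicits, rename.

Lemma widen_lift n (r : 'I_n) :
  widen_ord (leqnSn _) (lift ord0 r) = lift ord0 (widen_ord (leqnSn _) r).
Proof. exact: val_inj. Qed.

Section Shift.
Variable V : simplicial.

Definition shift : simplicial.
Proof.
refine (@Simplicial (fun n => V n.+1)
  (fun n r => face V n.+1 (lift ord0 r))
  (fun n r => degen V n.+1 (lift ord0 r)) _ _ _ _ _ _) => n.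
- by move=> p q x pq; rewrite -widen_lift; apply: face_face.
- by move=> p q x pq; rewrite -widen_lift; apply: degen_degen.
- by move=> p q x pq; rewrite -widen_lift; apply: face_degen_lt.
- by move=> q x; rewrite -widen_lift; apply: face_degen_id.
- by move=> q x; apply: face_degen_idS.
- by move=> p q x pq; rewrite -widen_lift; apply: face_degen_gt.
Defined.

End Shift.

Section Operators.
Variable V : simplicial.

(* The identity of [V m] when [m = n], and zero otherwise. *)
Definition ident m n : {linear V m -> V n} :=
  match @eqP _ m n with
  | ReflectT e => match e in _ = l return {linear V m -> V l} with
                  | erefl => idfun
                  end
  | ReflectF _ => \0
  end.

Lemma ident_refl m x : ident m m x = x.
Proof. by rewrite /ident; case: eqP => // e; rewrite (eq_axiomK e). Qed.

(* [degens nu m n], for [nu = [:: nu_1; ..; nu_j]], is [s_{nu_j} ... s_{nu_1}]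
   from [V m] to [V n] when [n = m + j], and zero for any other [n]. *)
Fixpoint degens (nu : seq nat) m n : {linear V m -> V n} :=
  match nu with
  | [::] => ident m n
  | r :: nu' => degens nu' m.+1 n \o degen V m (inord r)
  end.

Definition bdry n : {linear V n.+1 -> V n} := lin_sum predT (face V n).

End Operators.

(* A transformation of the components [V i ⊗ W j -> V k ⊗ W l]. *)
Definition transf i j k l :=
  forall V W : simplicial, {linear V i ⊗ W j -> V k ⊗ W l}.

Definition susp i j k l (t : transf i j k l) : transf i.+1 j.+1 k.+1 l.+1 :=
  fun V W => t (shift V) (shift W).

Definition tzero i j k l : transf i j k l := fun V W => \0.

Definition tadd i j k l (t u : transf i j k l) : transf i j k l :=
  fun V W => t V W \+ u V W.

Definition pre_d0l i j k l (t : transf i j k l) : transf i.+1 j k l :=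
  fun V W => t V W \o tmap (face V i ord0) idfun.

Definition pre_d0r i j k l (t : transf i j k l) : transf i j.+1 k l :=
  fun V W => t V W \o tmap idfun (face W j ord0).

Definition pre_s0r i j k l (t : transf i j.+1 k l) : transf i j k l :=
  fun V W => t V W \o tmap idfun (degen W j ord0).

Definition conjT i j k l (t : transf i j k l) : transf j i l k :=
  fun V W => tswap \o t W V \o tswap.

(* [EM i j n] is the Eilenberg-MacLane map D_{i,j} and [Dk k i j n] is D^k_{i,j}.
   The target degree [n] is a parameter of its own, to avoid transports along
   equations between degrees.  Its meaningful value is [i + j] for [EM], and
   [i + j - k] for [Dk k] and [phi k]. *)

Definition suspn i j (t : forall n, transf i j n n) n : transf i.+1 j.+1 n n :=
  match n with
  | 0 => @tzero _ _ _ _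
  | m.+1 => susp (t m)
  end.

Definition shuffle i j (mu : i.-tuple 'I_(i + j)) (nu : j.-tuple 'I_(i + j)) :=
  [&& sorted ltn [seq val r | r <- mu], sorted ltn [seq val r | r <- nu]
    & perm_eq (mu ++ nu) (enum 'I_(i + j))].

Definition EM i j n : transf i j n n := fun V W =>
  lin_sum (fun p : i.-tuple 'I_(i + j) * j.-tuple 'I_(i + j) =>
             shuffle p.1 p.2)
    (fun p => tmap (degens V [seq val r | r <- p.2] i n)
                   (degens W [seq val r | r <- p.1] j n)).

Fixpoint Dk k i j n : transf i j n n :=
  match k, i, j with
  | 0, 0, _ => @tzero _ _ _ _
  | 0, i'.+1, j => pre_s0r (suspn (EM i' j) n)
  | k'.+1, i'.+1, j'.+1 =>
      if odd k then tadd (suspn (Dk k' i' j') n) (pre_d0r (Dk k' i'.+1 j' n))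
      else tadd (suspn (Dk k' i' j') n) (pre_d0l (Dk k' i' j'.+1 n))
  | k'.+1, i'.+1, 0 =>
      if odd k then @tzero _ _ _ _ else pre_d0l (Dk k' i' 0 n)
  | k'.+1, 0, j'.+1 =>
      if odd k then pre_d0r (Dk k' 0 j' n) else @tzero _ _ _ _
  | k'.+1, 0, 0 => @tzero _ _ _ _
  end.

Definition phi k i j n : transf i j n n := fun V W =>
  if (i == k) && (j == k) then tmap (ident V i n) (ident W j n) else \0.

Definition pre_bdryl j k l (t : forall i, transf i j k l) i : transf i j k l :=
  match i with
  | 0 => @tzero _ _ _ _
  | i'.+1 => fun V W => t i' V W \o tmap (bdry V i') idfun
  end.

Definition pre_bdryr i k l (t : forall j, transf i j k l) j : transf i j k l :=
  match j with
  | 0 => @tzero _ _ _ _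
  | j'.+1 => fun V W => t j' V W \o tmap idfun (bdry W j')
  end.

(* [t ∂], where [∂] is the differential of the tensor product of complexes; the
   summands of [t] with a negative index are zero. *)
Definition pre_bdry k l (t : forall i j, transf i j k l) i j : transf i j k l :=
  tadd (pre_bdryl (t^~ j) i) (pre_bdryr (t i) j).

(* [∂ t], where [∂] is the differential of [n |-> V n ⊗ W n]. *)
Definition post_bdry i j n (t : transf i j n.+1 n.+1) : transf i j n n :=
  fun V W => lin_sum predT (fun r => tmap (face V n r) (face W n r)) \o t V W.

Record smap (V V' : simplicial) := SMap {
  smap_fun :> forall n, {linear V n -> V' n};
  smap_face : forall n r x,
    smap_fun n (face V n r x) = face V' n r (smap_fun n.+1 x);
  smap_degen : forall n r x,
    smap_fun n.+1 (degen V n r x) = degen V' n r (smap_fun n x)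
}.

Definition natural i j k l (t : transf i j k l) :=
  forall (V V' W W' : simplicial) (f : smap V V') (g : smap W W') x,
    tmap (f k) (g l) (t V W x) = t V' W' (tmap (f i) (g j) x).

Lemma tmap_comp (U U' U'' V V' V'' : lmodType 'F_2)
    (f : {linear U -> U'}) (f' : {linear U' -> U''}) (f'' : {linear U -> U''})
    (g : {linear V -> V'}) (g' : {linear V' -> V''}) (g'' : {linear V -> V''}) :
  (forall x, f' (f x) = f'' x) -> (forall x, g' (g x) = g'' x) ->
  forall t, tmap f' g' (tmap f g t) = tmap f'' g'' t.
Proof.
move=> ff gg; apply: (@tensor_ext _ _ _ _ (tmap f' g' \o tmap f g)) => u v /=.
by rewrite !tmap_tmul ff gg.
Qed.

Lemma natural_precomp i j i' j' k l (t : transf i' j' k l)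
    (a : forall V : simplicial, {linear V i -> V i'})
    (b : forall V : simplicial, {linear V j -> V j'}) :
  natural t ->
  (forall V V' (f : smap V V') x, f i' (a V x) = a V' (f i x)) ->
  (forall V V' (f : smap V V') x, f j' (b V x) = b V' (f j x)) ->
  natural (fun V W => t V W \o tmap (a V) (b W) : {linear _ -> _}).
Proof.
move=> tn an bn V V' W W' f g x /=; rewrite tn; congr (t _ _ _).
pose h := a V' \o f i : {linear _ -> _}.
pose h' := b W' \o g j : {linear _ -> _}.
by transitivity (tmap h h' x); [|symmetry]; apply: tmap_comp => y; rewrite ?an ?bn.
Qed.

Definition smap_shift V V' (f : smap V V') : smap (shift V) (shift V') :=
  @SMap (shift V) (shift V') (fun n => f n.+1)
    (fun n r => smap_face f (lift ord0 r)) (fun n r => smap_degen f (lift ord0 r)).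

Lemma natural_susp i j k l (t : transf i j k l) : natural t -> natural (susp t).
Proof.
by move=> tn V V' W W' f g x; apply: (tn _ _ _ _ (smap_shift f) (smap_shift g)).
Qed.

Lemma natural_tzero i j k l : natural (@tzero i j k l).
Proof. by move=> V V' W W' f g x; rewrite /tzero /= linear0. Qed.

Lemma natural_tadd i j k l (t u : transf i j k l) :
  natural t -> natural u -> natural (tadd t u).
Proof. by move=> tn un V V' W W' f g x; rewrite /tadd /= linearD tn un. Qed.

Lemma natural_suspn i j (t : forall n, transf i j n n) :
  (forall n, natural (t n)) -> forall n, natural (suspn t n).
Proof. by move=> tn [|n]; [apply: natural_tzero | apply: natural_susp]. Qed.

Lemma natural_pre_d0l i j k l (t : transf i j k l) :
  natural t -> natural (pre_d0l t).
Proof.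
by move=> tn; apply: (natural_precomp (b := fun=> idfun)) => // V V' f x;
  rewrite smap_face.
Qed.

Lemma natural_pre_d0r i j k l (t : transf i j k l) :
  natural t -> natural (pre_d0r t).
Proof.
by move=> tn; apply: (natural_precomp (a := fun=> idfun)) => // V V' f x;
  rewrite smap_face.
Qed.

Lemma natural_pre_s0r i j k l (t : transf i j.+1 k l) :
  natural t -> natural (pre_s0r t).
Proof.
by move=> tn; apply: (natural_precomp (a := fun=> idfun)) => // V V' f x;
  rewrite smap_degen.
Qed.

Lemma smap_ident V V' (f : smap V V') m n x :
  f n (ident V m n x) = ident V' m n (f m x).
Proof.
rewrite /ident; case: eqP => [e|_] /=; last by rewrite linear0.
by case: _ / e.
Qed.

Lemma smap_degens V V' (f : smap V V') nu m n x :
  f n (degens V nu m n x) = degens V' nu m n (f m x).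
Proof.
elim: nu m x => [|r nu IH] m x /=; first exact: smap_ident.
by rewrite IH smap_degen.
Qed.

Lemma natural_EM i j n : natural (EM i j n).
Proof.
move=> V V' W W' f g x; rewrite /EM /= /lin_sum linear_sum; apply: eq_bigr => p _.
pose h := degens V' [seq val r | r <- p.2] i n \o f i : {linear _ -> _}.
pose h' := degens W' [seq val r | r <- p.1] j n \o g j : {linear _ -> _}.
by transitivity (tmap h h' x); [|symmetry]; apply: tmap_comp => y; rewrite ?smap_degens.
Qed.

Lemma natural_Dk k i j n : natural (Dk k i j n).
Proof.
elim: k i j n => [|k IH] [|i] [|j] n /=; try exact: natural_tzero.
- by apply/natural_pre_s0r/natural_suspn => m; apply: natural_EM.
- by apply/natural_pre_s0r/natural_suspn => m; apply: natural_EM.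
- by case: ifP => _; [apply: natural_pre_d0r | apply: natural_tzero].
- by case: ifP => _; [apply: natural_tzero | apply: natural_pre_d0l].
- by case: ifP => _; apply: natural_tadd;
    [apply: natural_suspn | apply: natural_pre_d0r
    | apply: natural_suspn | apply: natural_pre_d0l].
Qed.

(* Main.v *)
Require Import Defs.
From mathcomp Require Import all_boot all_order all_algebra zify.
Import GRing.Theory.
Local Open Scope ring_scope.

(* All identities are checked on pure tensors u ⊗ v.  Write d = d_0 ⊗ 1,
   e = 1 ⊗ d_0 and [A] = A ∂ + ∂ A ([commutator A] below).  The shuffles
   beginning with 0 on one side or on the other give
     D = S(D)(1 ⊗ s_0) + S(D)(s_0 ⊗ 1),
   hence D = TDT and D^0 + T D^0 T = D + φ_0.  Since ∂ = d_0 + S(∂), and d_0 is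
   a simplicial map S V -> V, expanding gives
     [D^0] = D^0 d + D d + D^0 e + S(D) + S([D]) (1 ⊗ s_0),
   from which [D] = 0 by induction on the degree, and
     [B] = B d + B e + S([A]) + [A] e   whenever   B = S(A) + A e.
   The latter, with A = D^{k-2} and B = D^{k-1} or their conjugates by T
   according to the parity of k, is the induction step on k. *)

Set Implicit Arguments.
Unset Strict Implicit.
Unset Printing Implicit Defensive.

(** * Shuffles, generated by the place of 0 *)

Definition shuffle_l (p : seq nat * seq nat) := (0 :: map S p.1, map S p.2)%N.
Definition shuffle_r (p : seq nat * seq nat) := (map S p.1, 0 :: map S p.2)%N.

(** Placing 0 changes the sizes of the two sequences, so all sizes are generated at once; the
    (i,j)-shuffles are selected afterwards by [size p.1 == i]. *)
Fixpoint shuffles n : seq (seq nat * seq nat) :=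
  if n is n'.+1 then map shuffle_l (shuffles n') ++ map shuffle_r (shuffles n')
  else [:: ([::], [::])].

Lemma shufflesS n :
  shuffles n.+1 = map shuffle_l (shuffles n) ++ map shuffle_r (shuffles n).
Proof. by []. Qed.

Lemma shuffle_l_inj : injective shuffle_l.
Proof.
by move=> [a b] [c d] [] /(inj_map succn_inj) -> /(inj_map succn_inj) ->.
Qed.

Lemma shuffle_r_inj : injective shuffle_r.
Proof.
by move=> [a b] [c d] [] /(inj_map succn_inj) -> /(inj_map succn_inj) ->.
Qed.

Lemma uniq_shuffles n : uniq (shuffles n).
Proof.
elim: n => //= n IH.
rewrite cat_uniq !map_inj_uniq ?IH /=; [|exact: shuffle_r_inj|exact: shuffle_l_inj].
rewrite andbT; apply/hasPn => _ /mapP[p _ ->]; apply/mapP => -[q _ []].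
by case: p.1.
Qed.

Lemma sorted_mapS s : sorted ltn (map S s) = sorted ltn s.
Proof. by rewrite sorted_map; apply: eq_sorted => x y /=; rewrite ltnS. Qed.

Lemma sorted0_mapS s : sorted ltn (0%N :: map S s) = sorted ltn s.
Proof.
rewrite /= path_sortedE; last exact: ltn_trans.
by rewrite sorted_mapS all_map; case: all (@all_predT _ s) => //=.
Qed.

Lemma sorted_shift s : sorted ltn s ->
  (exists t, s = map S t) \/ (exists t, s = 0%N :: map S t).
Proof.
have mapS t : all (ltn 0) t -> t = map S (map predn t).
  move=> tP; rewrite -map_comp -[LHS]map_id; apply/eq_in_map => x /(allP tP) /=.
  by case: x.
case: s => [|[|x] s] /=; first by left; exists [::].
  rewrite path_sortedE; last exact: ltn_trans.
  by move=> /andP[/mapS -> _]; right; eexists.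
move=> /(order_path_min ltn_trans) xs; left; exists (x :: map predn s) => /=.
by rewrite -mapS //; apply: sub_all xs => y /=; apply: leq_trans.
Qed.

Lemma mem_shuffles n mu nu : ((mu, nu) \in shuffles n) =
  [&& sorted ltn mu, sorted ltn nu & perm_eq (mu ++ nu) (iota 0 n)].
Proof.
elim: n mu nu => [|n IH] mu nu.
  by case: mu nu => [|x mu] [|y nu] //; apply/esym/negP => /and3P[_ _ /perm_size].
have iotaS : iota 0 n.+1 = 0%N :: map S (iota 0 n) by rewrite /= -(iotaDl 1 0 n).
rewrite mem_cat.
apply/orP/and3P => [[] /mapP[[a b]]|].
- rewrite IH => /and3P[sa sb pab] [-> ->].
  rewrite sorted0_mapS sorted_mapS iotaS /= perm_cons -map_cat; split=> //.
  exact: perm_map.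
- rewrite IH => /and3P[sa sb pab] [-> ->].
  rewrite sorted0_mapS sorted_mapS iotaS /=; split=> //.
  rewrite -cat_rcons -cats1 -catA perm_catCA /= perm_cons -map_cat.
  exact: perm_map.
case=> smu snu; rewrite iotaS.
(* 0 heads exactly one of the two sequences: the first of the four cases contradicts its membership
   in the concatenation, the last its multiplicity. *)
have [[a emu]|[a emu]] := sorted_shift smu;
  have [[b enu]|[b enu]] := sorted_shift snu;
  move: smu snu; rewrite emu enu ?sorted0_mapS ?sorted_mapS => smu snu.
- rewrite -map_cat => /perm_mem/(_ 0%N).
  by rewrite inE eqxx => /mapP[].
- rewrite -cat_rcons -cats1 -catA perm_catCA /= perm_cons -map_cat => pab; right.
  apply/mapP; exists (a, b) => //; rewrite IH smu snu.
  exact: (perm_map_inj succn_inj).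
- rewrite /= perm_cons -map_cat => pab; left.
  apply/mapP; exists (a, b) => //; rewrite IH smu snu.
  exact: (perm_map_inj succn_inj).
- move=> /perm_uniq /=; rewrite mem_cat inE eqxx orbT /=.
  rewrite map_inj_uniq ?iota_uniq; last exact: succn_inj.
  by have -> : 0%N \notin [seq i.+1 | i <- iota 0 n] by apply/mapP => -[].
Qed.

(* Such an [nu] keeps the arguments of [inord] in [degens V nu m n] in range. *)
Fixpoint degenerable m nu :=
  if nu is r :: nu' then (r <= m)%N && degenerable m.+1 nu' else true.

Lemma degenerable_mapS m nu : degenerable m nu -> degenerable m.+1 (map S nu).
Proof. by elim: nu m => //= r nu IH m /andP[rm /IH]; rewrite ltnS rm. Qed.

(** Keeps every degeneracy index of a shuffle in range: a prefixed 0 always is, and raising the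
    other indices by one goes with raising the degree by one. *)
Lemma shufflesP n p : p \in shuffles n ->
  [/\ (size p.1 + size p.2 = n)%N, degenerable (size p.1) p.2
    & degenerable (size p.2) p.1].
Proof.
elim: n p => [|n IH] p; first by rewrite inE => /eqP ->.
rewrite mem_cat => /orP[] /mapP[q /IH[<- q2 q1] ->] /=; rewrite !size_map.
  by split; rewrite ?degenerable_mapS //.
by split; rewrite ?addnS ?degenerable_mapS //.
Qed.

(** Passes from the pairs of tuples that index [EM] to the recursive list. Neither side has
    duplicates, and i entries in the first sequence force j in the second, so the members agree. *)
Lemma perm_shuffles i j :
  perm_eq [seq ([seq val r | r <- p.1], [seq val r | r <- p.2]) |
            p : i.-tuple 'I_(i + j) * j.-tuple 'I_(i + j) <-
              enum [pred p | shuffle p.1 p.2]]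
    [seq p <- shuffles (i + j) | size p.1 == i].
Proof.
have val_enum s : perm_eq s (enum 'I_(i + j)) =
    perm_eq (map val s) (iota 0 (i + j)).
  rewrite -val_enum_ord; apply/idP/idP => [|/(perm_map_inj val_inj) //].
  exact: perm_map.
have tupleE k (s : seq nat) : all (ltn^~ (i + j)%N) s -> size s = k ->
    {t : k.-tuple 'I_(i + j) | map val t = s}.
  move=> slt sk; have [t et] : {t : seq 'I_(i + j) | map val t = s}.
    elim: s slt {sk} => [_|x s IH /= /andP[xlt /IH[t <-]]]; first by exists [::].
    by exists (Ordinal xlt :: t).
  have tk : size t == k by rewrite -sk -et size_map.
  by exists (Tuple tk).
apply: uniq_perm.
- rewrite map_inj_in_uniq ?enum_uniq // => -[a b] [c d] _ _ /= [].
  by move=> /(inj_map val_inj)/val_inj -> /(inj_map val_inj)/val_inj ->.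
- exact/filter_uniq/uniq_shuffles.
case=> mu nu; rewrite mem_filter mem_shuffles /=.
apply/mapP/idP => [[[a b]]|].
  rewrite mem_enum => /and3P[/= sa sb pab] [-> ->].
  by rewrite size_map size_tuple eqxx sa sb -map_cat -val_enum.
case/and4P=> /eqP smu sa sb pab.
have snu : size nu = j.
  by move/perm_size: (pab); rewrite size_cat size_iota smu => /addnI.
have /allP lt_all : all (ltn^~ (i + j)%N) (mu ++ nu).
  by rewrite (perm_all _ pab); apply/allP => x; rewrite mem_iota.
have [|a ea] := tupleE i mu _ smu.
  by apply/allP => x xmu; apply: lt_all; rewrite mem_cat xmu.
have [|b eb] := tupleE j nu _ snu.
  by apply/allP => x xnu; apply: lt_all; rewrite mem_cat xnu orbT.
exists (a, b); last by rewrite /= ea eb.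
by rewrite mem_enum; apply/and3P; rewrite /= val_enum map_cat ea eb.
Qed.

(** * Recursion and symmetry of the Eilenberg-MacLane map *)

Lemma EM_shuffles i j n V W u v :
  EM i j n V W (tmul u v) =
  \sum_(p <- shuffles (i + j) | size p.1 == i)
    tmul (degens V p.2 i n u) (degens W p.1 j n v).
Proof.
rewrite -big_filter -(perm_big _ (perm_shuffles i j)) big_map big_enum.
rewrite /EM /= /lin_sum; apply: eq_big => [p|p _]; first by rewrite inE.
by rewrite tmap_tmul.
Qed.

Lemma ident_shift V m n : ident (shift V) m n =1 ident V m.+1 n.+1.
Proof.
move=> x; case: (eqVneq m n) => [<-|mn]; first by rewrite !ident_refl.
rewrite /ident; case: eqP => [e|_]; first by rewrite e eqxx in mn.
by case: eqP => // e; have [e'] := e; rewrite e' eqxx in mn.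
Qed.

(** The range condition matters: for r > m, [inord] defaults to 0, so the left side would use s_0
    and the right side s_1. *)
Lemma degens_shift V nu m n x : degenerable m nu ->
  degens V (map S nu) m.+1 n.+1 x = degens (shift V) nu m n x.
Proof.
elim: nu m x => [|r nu IH] m x /=; first by rewrite ident_shift.
case/andP=> rm /IH <-; congr (degens _ _ _ _ (degen V _ _ _)).
by apply: val_inj; rewrite /= /bump !inordK ?ltnS.
Qed.

Lemma EM00 V W u v : EM 0 0 0 V W (tmul u v) = tmul u v.
Proof. by rewrite EM_shuffles big_cons big_nil /= !ident_refl addr0. Qed.

Lemma inord0 n : inord 0 = ord0 :> 'I_n.+1.
Proof. by apply: val_inj; rewrite /= inordK. Qed.

(** When 0 heads the first sequence, s_0 acts first on the right factor, and all remaining indices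
    are raised by one, which is suspension. *)
Lemma sum_shuffle_l (V W : simplicial) i j n (u : V i.+1) (v : W j) :
  \sum_(p <- map shuffle_l (shuffles (i + j)) | size p.1 == i.+1)
    tmul (degens V p.2 i.+1 n.+1 u) (degens W p.1 j n.+1 v) =
  EM i j n (shift V) (shift W) (tmul (u : shift V i) (degen W j ord0 v)).
Proof.
rewrite EM_shuffles big_map /=.
rewrite big_seq_cond [RHS]big_seq_cond; apply: eq_big => [p|p].
  by rewrite /= size_map eqSS.
case/andP=> /shufflesP[e p2 p1]; rewrite /= size_map => /eqP[ep1].
move: e p2; rewrite ep1 => /addnI ep2 p2; rewrite ep2 in p1.
by rewrite inord0 !degens_shift.
Qed.

Lemma sum_shuffle_r (V W : simplicial) i j n (u : V i) (v : W j.+1) :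
  \sum_(p <- map shuffle_r (shuffles (i + j)) | size p.1 == i)
    tmul (degens V p.2 i n.+1 u) (degens W p.1 j.+1 n.+1 v) =
  EM i j n (shift V) (shift W) (tmul (degen V i ord0 u) (v : shift W j)).
Proof.
rewrite EM_shuffles big_map /=.
rewrite big_seq_cond [RHS]big_seq_cond; apply: eq_big => [p|p].
  by rewrite /= size_map.
case/andP=> /shufflesP[e p2 p1]; rewrite /= size_map => /eqP ep1.
move: e p2; rewrite ep1 => /addnI ep2 p2; rewrite ep2 in p1.
by rewrite inord0 !degens_shift.
Qed.

Lemma EM_S0 i n (V W : simplicial) (u : V i.+1) (v : W 0) :
  EM i.+1 0 n.+1 V W (tmul u v) =
  EM i 0 n (shift V) (shift W) (tmul (u : shift V i) (degen W 0 ord0 v)).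
Proof.
rewrite EM_shuffles addSn shufflesS big_cat sum_shuffle_l /= big_map.
(* With j = 0 the second sequence is empty, so 0 cannot lie in it. *)
rewrite big1_seq ?addr0 //.
move=> p /= /andP[+ /shufflesP[e _ _]].
by rewrite size_map => /eqP ep; rewrite ep addn0 addSn -{2}[i]addn0 in e; lia.
Qed.

Lemma EM_0S j n (V W : simplicial) (u : V 0) (v : W j.+1) :
  EM 0 j.+1 n.+1 V W (tmul u v) =
  EM 0 j n (shift V) (shift W) (tmul (degen V 0 ord0 u) (v : shift W j)).
Proof.
rewrite EM_shuffles shufflesS big_cat (@sum_shuffle_r V W 0 j) /= big_map.
by rewrite big1_seq ?add0r.
Qed.

Lemma EM_SS i j n (V W : simplicial) (u : V i.+1) (v : W j.+1) :
  EM i.+1 j.+1 n.+1 V W (tmul u v) =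
  EM i j.+1 n (shift V) (shift W) (tmul (u : shift V i) (degen W j.+1 ord0 v)) +
  EM i.+1 j n (shift V) (shift W) (tmul (degen V i.+1 ord0 u) (v : shift W j)).
Proof.
rewrite EM_shuffles addSn shufflesS big_cat sum_shuffle_l.
by rewrite -addSnnS sum_shuffle_r.
Qed.

(** By induction on the degree: T exchanges the two summands of the recursion [EM_SS]. *)
Lemma EM_sym n i j (V W : simplicial) (u : V i) (v : W j) : n = (i + j)%N ->
  EM i j n V W (tmul u v) = tswap (EM j i n W V (tmul v u)).
Proof.
elim: n i j V W u v => [|n IH] [|i] [|j] V W u v //.
- by rewrite !EM00 tswap_tmul.
- by case=> e; rewrite EM_0S EM_S0 IH.
- by rewrite addn0 => -[e]; rewrite EM_0S EM_S0 IH // addn0.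
rewrite addnS => -[e]; rewrite !EM_SS linearD /= addrC.
by congr (_ + _); apply: (IH _ _ (shift V) (shift W)); rewrite // -addSnnS.
Qed.

(** * Sums in characteristic 2 *)

Lemma F2_addxx (U : lmodType 'F_2) (x : U) : x + x = 0.
Proof. by rewrite -[x]scale1r -scalerDl -[1 + 1]/(2%:R) pchar_Zp ?scale0r. Qed.

Lemma F2_addKx (U : lmodType 'F_2) (x y : U) : x + (x + y) = y.
Proof. by rewrite addrA F2_addxx add0r. Qed.

(** The trailing 0 gives every summand, the last one included, the shape x + r that [F2_cancel]
    matches. *)
Lemma F2_eq (U : lmodType 'F_2) (x y : U) : x + (y + 0) = 0 -> x = y.
Proof.
rewrite addr0 => /(congr1 (+%R^~ y)).
by rewrite -addrA F2_addxx addr0 add0r.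
Qed.

Lemma F2_skip (U : lmodType 'F_2) (x y r s : U) :
  x + r = s -> x + (y + r) = y + s.
Proof. by move=> <-; rewrite addrCA. Qed.

Ltac F2_cancel :=
  lazymatch goal with
  | |- ?x + (?x + _) = _ => apply: F2_addKx
  | |- _ + (_ + _) = _ => apply: F2_skip; F2_cancel
  end.

(** Gathers both sides into one sum and repeatedly cancels its first summand against the next copy.
    Below it is run on variables, and the resulting identity is then applied to the actual terms. *)
Ltac F2_sum :=
  rewrite ?(addr0, add0r); apply: F2_eq; rewrite -?addrA;
  repeat (refine (etrans (y := _) _ _); [F2_cancel|]); by rewrite ?addr0.

(** * The face d_0 and the differentials under suspension *)

Lemma smap_bdry V V' (f : smap V V') n x :
  f n (bdry V n x) = bdry V' n (f n.+1 x).
Proof.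
by rewrite /bdry /= /lin_sum linear_sum; apply: eq_bigr => r _; rewrite smap_face.
Qed.

Lemma d0s0 (V : simplicial) n (x : V n) : face V n ord0 (degen V n ord0 x) = x.
Proof.
have {1}-> : ord0 = widen_ord (leqnSn _) ord0 :> 'I_n.+2 by apply: val_inj.
exact: face_degen_id.
Qed.

Lemma d1s0 (V : simplicial) n (x : V n) :
  face V n (lift ord0 ord0) (degen V n ord0 x) = x.
Proof. exact: face_degen_idS. Qed.

Lemma bdry0 (V : simplicial) (x : V 1) :
  bdry V 0 x = face V 0 ord0 x + face V 0 (lift ord0 ord0) x.
Proof. by rewrite /bdry /= /lin_sum !big_ord_recl big_ord0 addr0. Qed.

(** The identities d_0 d_{r+1} = d_r d_0 and d_0 s_{r+1} = s_r d_0. Naturality along this map moves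
    d_0 ⊗ d_0 past any suspended natural transformation ([natural_d0]). *)
Definition d0_smap V : smap (shift V) V.
Proof.
refine (@SMap (shift V) V (fun n => face V n ord0) _ _) => n r x.
  by rewrite /= face_face //; congr (face _ _ _ (face _ _ _ _)); apply: val_inj.
have -> : ord0 = widen_ord (leqnSn _) ord0 :> 'I_n.+3 by apply: val_inj.
by rewrite /= face_degen_lt.
Defined.

Lemma bdry_shift (V : simplicial) n (x : V n.+2) :
  bdry V n.+1 x = face V n.+1 ord0 x + bdry (shift V) n x.
Proof. by rewrite /bdry /= /lin_sum big_ord_recl. Qed.

Lemma d0_bdry (V : simplicial) n (x : V n.+2) :
  face V n ord0 (bdry (shift V) n x) = bdry V n (face V n.+1 ord0 x).
Proof. exact: (smap_bdry (d0_smap V)). Qed.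

(** From d_1 s_0 = 1 and d_{r+1} s_0 = s_0 d_r for r >= 1; the term s_0 d_0 removes the summand r =
    0 of s_0 ∂. *)
Lemma bdry_s0 (V : simplicial) n (x : V n.+1) :
  bdry (shift V) n (degen V n.+1 ord0 x) =
  x + (degen V n ord0 (bdry V n x) + degen V n ord0 (face V n ord0 x)).
Proof.
rewrite -linearD /bdry /= /lin_sum big_ord_recl [in RHS]big_ord_recl /=.
rewrite addrAC F2_addxx add0r; congr (_ + _); first exact: d1s0.
rewrite linear_sum; apply: eq_bigr => r _.
have -> : ord0 = widen_ord (leqnSn _) ord0 :> 'I_n.+2 by apply: val_inj.
by rewrite -face_degen_gt //; congr (face _ _ _ _); apply: val_inj.
Qed.

Definition diag_bdry (V W : simplicial) n :
    {linear V n.+1 ⊗ W n.+1 -> V n ⊗ W n} :=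
  lin_sum predT (fun r => tmap (face V n r) (face W n r)).

Lemma diag_bdry_shift (V W : simplicial) n (x : (V n.+2 ⊗ W n.+2)%type) :
  diag_bdry V W n.+1 x = tmap (face V n.+1 ord0) (face W n.+1 ord0) x +
  diag_bdry (shift V) (shift W) n x.
Proof. by rewrite /diag_bdry /= /lin_sum big_ord_recl. Qed.

Lemma diag_bdry0 (V W : simplicial) (x : (V 1 ⊗ W 1)%type) :
  diag_bdry V W 0 x = tmap (face V 0 ord0) (face W 0 ord0) x
  + tmap (face V 0 (lift ord0 ord0)) (face W 0 (lift ord0 ord0)) x.
Proof. by rewrite /diag_bdry /= /lin_sum !big_ord_recl big_ord0 addr0. Qed.

Lemma natural_d0 i j n (t : transf i j n n) (V W : simplicial)
    (u : V i.+1) (v : W j.+1) :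
  natural t ->
  tmap (face V n ord0) (face W n ord0)
    (t (shift V) (shift W) (tmul (u : shift V i) (v : shift W j))) =
  t V W (tmul (face V i ord0 u) (face W j ord0 v)).
Proof.
move=> tn; have := tn _ _ _ _ (d0_smap V) (d0_smap W) (tmul u v).
by rewrite tmap_tmul.
Qed.

(** * Commutators with the differential, and conjugation by T *)

Definition commutator (A : forall i j n, transf i j n n) i j n : transf i j n n :=
  tadd (pre_bdry (fun i j => A i j n) i j) (post_bdry (A i j n.+1)).

Lemma commutatorE A i j n V W x : commutator A i j n V W x =
  pre_bdryl (fun i => A i j n) i V W x + pre_bdryr (fun j => A i j n) j V W x
  + diag_bdry V W n (A i j n.+1 V W x).
Proof. by []. Qed.

Lemma pre_bdrylS j k l (t : forall i, transf i j k l) i V W u v :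
  pre_bdryl t i.+1 V W (tmul u v) = t i V W (tmul (bdry V i u) v).
Proof. by rewrite /pre_bdryl /= tmap_tmul. Qed.

Lemma pre_bdryrS i k l (t : forall j, transf i j k l) j V W u v :
  pre_bdryr t j.+1 V W (tmul u v) = t j V W (tmul u (bdry W j v)).
Proof. by rewrite /pre_bdryr /= tmap_tmul. Qed.

Lemma tmulDl (U V : lmodType 'F_2) (u u' : U) (v : V) :
  tmul (u + u') v = tmul u v + tmul u' v.
Proof. exact: (linearDl (tmul : {bilinear U -> V -> _})). Qed.

Lemma tmulDr (U V : lmodType 'F_2) (u : U) (v v' : V) :
  tmul u (v + v') = tmul u v + tmul u v'.
Proof. exact: (linearDr (tmul : {bilinear U -> V -> _})). Qed.

Lemma tswapK (U V : lmodType 'F_2) : cancel (@tswap _ U V) (@tswap _ V U).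
Proof.
apply: (@tensor_ext _ _ _ _ (tswap \o tswap) idfun) => u v.
by rewrite /= !tswap_tmul.
Qed.

Lemma tswapD (U V : lmodType 'F_2) (x y : (U ⊗ V)%type) :
  tswap (x + y) = tswap x + tswap y.
Proof. exact: linearD. Qed.

Lemma tswap_tmap (U U' V V' : lmodType 'F_2) (f : {linear U -> U'})
    (g : {linear V -> V'}) x : tswap (tmap f g x) = tmap g f (tswap x).
Proof.
move: x; apply: (@tensor_ext _ _ _ _ (tswap \o tmap f g) (tmap g f \o tswap)).
by move=> u v; rewrite /= tmap_tmul !tswap_tmul tmap_tmul.
Qed.

Lemma conjT_tmul i j k l (t : transf i j k l) (V W : simplicial)
    (u : V j) (v : W i) :
  conjT t V W (tmul u v) = tswap (t W V (tmul v u)).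
Proof. by rewrite /conjT /= tswap_tmul. Qed.

Lemma conjT_eq0 i j k l (t : transf i j k l) :
  (forall V W x, t V W x = 0) -> forall V W x, conjT t V W x = 0.
Proof. by move=> t0 V W x; rewrite /conjT /= t0 linear0. Qed.

Lemma natural_conj i j k l (t : transf i j k l) : natural t -> natural (conjT t).
Proof.
by move=> tn V V' W W' f g x; rewrite /conjT /= -tswap_tmap tn -tswap_tmap.
Qed.

Lemma diag_bdry_tswap (V W : simplicial) n x :
  diag_bdry V W n (tswap x) = tswap (diag_bdry W V n x).
Proof.
rewrite /diag_bdry /= /lin_sum linear_sum; apply: eq_bigr => r _.
by rewrite tswap_tmap.
Qed.

(** * D^k and φ_k on pure tensors *)

Lemma Dk0_S i j n (V W : simplicial) (u : V i.+1) (v : W j) :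
  Dk 0 i.+1 j n.+1 V W (tmul u v) =
  EM i j n (shift V) (shift W) (tmul (u : shift V i) (degen W j ord0 v)).
Proof. by rewrite /= tmap_tmul. Qed.

(** The upper index is k + 1, so [odd k] selects the even case of the definition. *)
Lemma DkSS k i j n (V W : simplicial) (u : V i.+1) (v : W j.+1) :
  Dk k.+1 i.+1 j.+1 n.+1 V W (tmul u v) =
  Dk k i j n (shift V) (shift W) (tmul (u : shift V i) (v : shift W j))
  + if odd k then Dk k i j.+1 n.+1 V W (tmul (face V i ord0 u) v)
    else Dk k i.+1 j n.+1 V W (tmul u (face W j ord0 v)).
Proof.
by rewrite /=; case: (odd k); rewrite /= tmap_tmul.
Qed.

Lemma Dk_0l k j n (V W : simplicial) x : Dk k 0 j n V W x = 0.
Proof.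
elim: k j x => [|k IH] [|j] x //.
by rewrite [Dk k.+1 _ _ _]/=; case: ifP => // _; apply: IH.
Qed.

(** The recursion stops at D^1_{i,0} = 0 and never reaches D^0_{i,0}, which need not vanish. *)
Lemma Dk_0r k i n (V W : simplicial) x : Dk k.+1 i 0 n V W x = 0.
Proof.
elim: k i x => [|k IH] [|i] x //.
by rewrite [Dk k.+2 _ _ _]/=; case: ifP => // _; apply: IH.
Qed.

Lemma phi_eq0 k i j n (V W : simplicial) x : ~~ ((i == k) && (j == k)) ->
  phi k i j n V W x = 0.
Proof. by rewrite /phi; case: ifP. Qed.

Lemma phi_diag k n (V W : simplicial) (u : V k) (v : W k) :
  phi k k k n V W (tmul u v) = tmul (ident V k n u) (ident W k n v).
Proof. by rewrite /phi eqxx tmap_tmul. Qed.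

Lemma phi_shift k i j n (V W : simplicial) (u : V i.+1) (v : W j.+1) :
  phi k i j n (shift V) (shift W) (tmul (u : shift V i) (v : shift W j)) =
  phi k.+1 i.+1 j.+1 n.+1 V W (tmul u v).
Proof.
by rewrite /phi !eqSS; case: ifP => // _; rewrite !tmap_tmul !ident_shift.
Qed.

Definition conj_family (A : forall i j n, transf i j n n) i j n :=
  conjT (A j i n).

(* Otherwise rewriting identifies distinct transformations that both reduce to
   zero. *)
Opaque EM Dk phi bdry tmul tmap tswap diag_bdry commutator conjT.
Opaque pre_bdryl pre_bdryr.

(** * The commutator of D^0, and D as a chain map *)

Lemma commutator_Dk0_S i j n (V W : simplicial) (u : V i.+1) (v : W j) :
  commutator (Dk 0) i.+1 j n.+1 V W (tmul u v) =
  Dk 0 i j n.+1 V W (tmul (face V i ord0 u) v)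
  + EM i j n.+1 V W (tmul (face V i ord0 u) v)
  + match j return W j -> (V n.+1 ⊗ W n.+1)%type with
    | 0 => fun=> 0
    | j'.+1 => fun v => Dk 0 i.+1 j' n.+1 V W (tmul u (face W j' ord0 v))
        + EM i j' n (shift V) (shift W) (tmul (u : shift V i) (v : shift W j'))
    end v
  + commutator EM i j n (shift V) (shift W)
      (tmul (u : shift V i) (degen W j ord0 v)).
Proof.
rewrite [in LHS]commutatorE [in RHS]commutatorE pre_bdrylS Dk0_S.
(* The summand d_0 ⊗ d_0 of the diagonal ∂ yields D d, because d_0 s_0 = 1. *)
rewrite diag_bdry_shift natural_d0; last exact: natural_EM.
rewrite d0s0.
have -> : Dk 0 i j n.+1 V W (tmul (bdry V i u) v) =
    Dk 0 i j n.+1 V W (tmul (face V i ord0 u) v) +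
    pre_bdryl (fun i => EM i j n) i (shift V) (shift W)
      (tmul (u : shift V i) (degen W j ord0 v)).
  case: i u => [|i] u; first by rewrite addr0.
  by rewrite bdry_shift tmulDl linearD !Dk0_S pre_bdrylS.
have -> : pre_bdryr (fun j => Dk 0 i.+1 j n.+1) j V W (tmul u v) =
    match j return W j -> (V n.+1 ⊗ W n.+1)%type with
    | 0 => fun=> 0
    | j'.+1 => fun v => Dk 0 i.+1 j' n.+1 V W (tmul u (face W j' ord0 v))
        + EM i j' n (shift V) (shift W) (tmul (u : shift V i) (v : shift W j'))
    end v + pre_bdryr (fun j => EM i j n) j (shift V) (shift W)
      (tmul (u : shift V i) (degen W j ord0 v)).
  case: j v => [|j] v; first by rewrite addr0.
  (* The identity S(∂) s_0 = 1 + s_0 ∂ + s_0 d_0 accounts for the terms S(D) and D^0 e. *)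
  rewrite !pre_bdryrS bdry_s0 !(tmulDr, linearD) !Dk0_S.
  have F2_id (M : lmodType 'F_2) (x y z : M) : x = y + z + (z + (x + y)) by F2_sum.
  exact: F2_id.
have F2_id (M : lmodType 'F_2) (x y z s t w : M) :
  x + y + (z + t) + (s + w) = x + s + z + (y + t + w) by F2_sum.
exact: F2_id.
Qed.

(** The two summands of the recursion for D are D^0 and, by the symmetry of D, T D^0 T. In degree
    (0,0) both vanish while D is the identity, whence φ_0. *)
Lemma Dk0_conj n i j (V W : simplicial) (u : V i) (v : W j) : n = (i + j)%N ->
  Dk 0 i j n V W (tmul u v) + tswap (Dk 0 j i n W V (tmul v u)) =
  EM i j n V W (tmul u v) + phi 0 i j n V W (tmul u v).
Proof.
case: i j n u v => [|i] [|j] [|n] u v //; rewrite ?addn0 ?addSn => e.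
- rewrite EM00 !Dk_0l linear0 phi_diag !ident_refl.
  by rewrite addr0 F2_addxx.
- rewrite Dk_0l add0r addr0 Dk0_S EM_0S; apply/esym.
  by apply: (@EM_sym n 0 j (shift V) (shift W)); case: e.
- by rewrite Dk_0l linear0 Dk0_S EM_S0.
rewrite phi_eq0 // addr0 !Dk0_S EM_SS; congr (_ + _).
by apply/esym/(@EM_sym n i.+1 j (shift V) (shift W)); lia.
Qed.

Lemma commutator_Dk0_0 j n (V W : simplicial) (u : V 0) (v : W j) :
  commutator (Dk 0) 0 j n V W (tmul u v) = 0.
Proof.
rewrite commutatorE Dk_0l linear0 addr0 add0r.
by case: j v => [|j] v //; rewrite pre_bdryrS Dk_0l.
Qed.

(** Here D^0 = D on d_0 u ⊗ v, so D^0 d and D d cancel. The degree starts at 2 because for u of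
    degree 1 the term φ_0 would survive. *)
Lemma commutator_Dk0_S0 i n (V W : simplicial) (u : V i.+2) (v : W 0) :
  n = i ->
  commutator EM i.+1 0 n (shift V) (shift W)
    (tmul (u : shift V i.+1) (degen W 0 ord0 v)) = 0 ->
  commutator (Dk 0) i.+2 0 n.+1 V W (tmul u v) = 0.
Proof.
move=> ->; rewrite commutator_Dk0_S => ->; rewrite !addr0.
have := Dk0_conj (face V i.+1 ord0 u) v (esym (addn0 i.+1)).
by rewrite Dk_0l linear0 (phi_eq0 _) // !addr0 => ->; rewrite F2_addxx.
Qed.

(** As D^0 + D = T D^0 T in positive total degree, D^0 d + D d becomes T D^0 T d. The resulting sum
    is invariant under T, which makes [D^0] and [T D^0 T] cancel in [commutator_EM]. *)
Lemma commutator_Dk0_SS i j n (V W : simplicial) (u : V i.+1) (v : W j.+1) :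
  n = (i + j)%N ->
  commutator EM i j.+1 n (shift V) (shift W)
    (tmul (u : shift V i) (degen W j.+1 ord0 v)) = 0 ->
  commutator (Dk 0) i.+1 j.+1 n.+1 V W (tmul u v) =
  Dk 0 i.+1 j n.+1 V W (tmul u (face W j ord0 v))
  + tswap (Dk 0 j.+1 i n.+1 W V (tmul v (face V i ord0 u)))
  + EM i j n (shift V) (shift W) (tmul (u : shift V i) (v : shift W j)).
Proof.
move=> e; rewrite commutator_Dk0_S => ->.
have e' : n.+1 = (i + j.+1)%N by rewrite e addnS.
have := Dk0_conj (face V i ord0 u) v e'.
rewrite (phi_eq0 _) ?andbF // addr0 => <-.
have F2_id (M : lmodType 'F_2) (x y z t : M) :
  x + (x + y) + (z + t) + 0 = z + y + t by F2_sum.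
exact: F2_id.
Qed.

(** T exchanges the two halves of the tensor product differential and commutes with the diagonal
    one. *)
Lemma commutator_conj A i j n (V W : simplicial) (u : V i) (v : W j) :
  commutator (conj_family A) i j n V W (tmul u v) =
  tswap (commutator A j i n W V (tmul v u)).
Proof.
rewrite !commutatorE !linearD -diag_bdry_tswap.
congr (_ + diag_bdry _ _ _ _); last exact: conjT_tmul.
rewrite addrC; congr (_ + _).
  case: j v => [|j] v; first by rewrite linear0.
  by rewrite pre_bdryrS pre_bdrylS conjT_tmul.
case: i u => [|i] u; first by rewrite linear0.
by rewrite pre_bdryrS pre_bdrylS conjT_tmul.
Qed.

Lemma EM_split n i j (V W : simplicial) (u : V i) (v : W j) :
  n.+1 = (i + j)%N ->
  EM i j n.+1 V W (tmul u v) =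
  Dk 0 i j n.+1 V W (tmul u v) + conj_family (Dk 0) i j n.+1 V W (tmul u v).
Proof.
move=> e; rewrite conjT_tmul Dk0_conj // [X in _ = _ + X]phi_eq0 ?addr0 //.
by apply/negP => /andP[/eqP ei /eqP ej]; rewrite ei ej in e.
Qed.

(** Total degree at least 2 stays positive after applying ∂, so φ_0 does not appear in
    [EM_split]. *)
Lemma commutator_EM_split n i j (V W : simplicial) (u : V i) (v : W j) :
  n.+2 = (i + j)%N ->
  commutator EM i j n.+1 V W (tmul u v) =
  commutator (Dk 0) i j n.+1 V W (tmul u v) +
  commutator (conj_family (Dk 0)) i j n.+1 V W (tmul u v).
Proof.
move=> e; rewrite !commutatorE EM_split // linearD.
have -> : pre_bdryl (fun i => EM i j n.+1) i V W (tmul u v) =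
    pre_bdryl (fun i => Dk 0 i j n.+1) i V W (tmul u v) +
    pre_bdryl (fun i => conj_family (Dk 0) i j n.+1) i V W (tmul u v).
  case: i u e => [|i] u e; first by rewrite addr0.
  by rewrite !pre_bdrylS EM_split //; case: e.
have -> : pre_bdryr (fun j => EM i j n.+1) j V W (tmul u v) =
    pre_bdryr (fun j => Dk 0 i j n.+1) j V W (tmul u v) +
    pre_bdryr (fun j => conj_family (Dk 0) i j n.+1) j V W (tmul u v).
  case: j v e => [|j] v e; first by rewrite addr0.
  by rewrite !pre_bdryrS EM_split //; lia.
have F2_id (M : lmodType 'F_2) (x y z t s w : M) :
  x + y + (z + t) + (s + w) = x + z + s + (y + t + w) by F2_sum.
exact: F2_id.
Qed.

Lemma commutator_EM n i j (V W : simplicial) (u : V i) (v : W j) :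
  n.+1 = (i + j)%N -> commutator EM i j n V W (tmul u v) = 0.
Proof.
elim: n i j V W u v => [|n IH] i j V W u v e.
  (* Total degree 1, where the splitting fails, is computed directly from d_0 s_0 = d_1 s_0 = 1. *)
  rewrite commutatorE diag_bdry0.
  case: i j u v e => [|[|i]] [|[|j]] // u v _.
    rewrite add0r pre_bdryrS EM00 EM_0S EM00 !tmap_tmul d0s0 d1s0 -tmulDr.
    by rewrite bdry0 F2_addxx.
  rewrite addr0 pre_bdrylS EM00 EM_S0 EM00 !tmap_tmul d0s0 d1s0 -tmulDl.
  by rewrite bdry0 F2_addxx.
rewrite commutator_EM_split // commutator_conj.
case: i j u v e => [|i] [|j] u v e //.
- rewrite commutator_Dk0_0 add0r; case: j v e => [|j] // v [e].
  by rewrite commutator_Dk0_S0 ?linear0 //; apply: IH; rewrite ?addn0 ?e.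
- case: i u e => [|i] // u [e].
  rewrite commutator_Dk0_0 linear0 addr0.
  by rewrite commutator_Dk0_S0 //; [|apply: IH]; lia.
rewrite !commutator_Dk0_SS; try (by apply: IH; lia); try lia.
rewrite !linearD -(@EM_sym n i j (shift V) (shift W)); last lia.
rewrite tswapK.
have F2_id (M : lmodType 'F_2) (x y z : M) : x + y + z + (y + x + z) = 0.
  by F2_sum.
exact: F2_id.
Qed.

(** * Induction on k *)

Lemma commutator_step (A B : forall i j n, transf i j n n) :
  (forall i j n, natural (A i j n)) ->
  (forall j n V W x, A 0 j n V W x = 0) ->
  (forall j n V W x, B 0 j n V W x = 0) ->
  (forall i n V W x, B i 0 n V W x = 0) ->
  (forall i j n (V W : simplicial) (u : V i.+1) (v : W j.+1),
    B i.+1 j.+1 n.+1 V W (tmul u v) =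
    A i j n (shift V) (shift W) (tmul (u : shift V i) (v : shift W j))
    + A i.+1 j n.+1 V W (tmul u (face W j ord0 v))) ->
  forall i j n (V W : simplicial) (u : V i.+1) (v : W j.+1),
  commutator B i.+1 j.+1 n.+1 V W (tmul u v) =
  B i j.+1 n.+1 V W (tmul (face V i ord0 u) v)
  + B i.+1 j n.+1 V W (tmul u (face W j ord0 v))
  + commutator A i j n (shift V) (shift W)
      (tmul (u : shift V i) (v : shift W j))
  + commutator A i.+1 j n.+1 V W (tmul u (face W j ord0 v)).
Proof.
move=> nA A0l B0l B0r BE i j n V W u v.
(* After expanding ∂ = d_0 + S(∂), the term A (d_0 ⊗ d_0) arises once from B (∂ ⊗ 1) and once, by
   naturality along d_0, from ∂ S(A); the copies cancel. *)
rewrite !commutatorE pre_bdryrS !pre_bdrylS BE linearD.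
rewrite diag_bdry_shift natural_d0 //.
have -> : B i j.+1 n.+1 V W (tmul (bdry V i u) v) =
    B i j.+1 n.+1 V W (tmul (face V i ord0 u) v)
    + (pre_bdryl (fun i => A i j n) i (shift V) (shift W)
         (tmul (u : shift V i) (v : shift W j))
       + (A i j n.+1 V W (tmul (bdry V i u) (face W j ord0 v))
         + A i j n.+1 V W (tmul (face V i ord0 u) (face W j ord0 v)))).
  (* The recursion for B needs positive degrees; when ∂ lowers i to 0, the vanishing of A and B
     there replaces it. *)
  case: i u => [|i] u; first by rewrite !B0l !A0l !addr0.
  rewrite !bdry_shift !(tmulDl, linearD) !BE pre_bdrylS.
  have F2_id (M : lmodType 'F_2) (x y z t s : M) :
    x + y + (z + t) = x + y + (z + (s + t + s)) by F2_sum.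
  exact: F2_id.
have -> : B i.+1 j n.+1 V W (tmul u (bdry W j v)) =
    B i.+1 j n.+1 V W (tmul u (face W j ord0 v))
    + (pre_bdryr (fun j => A i j n) j (shift V) (shift W)
         (tmul (u : shift V i) (v : shift W j))
       + pre_bdryr (fun j => A i.+1 j n.+1) j V W (tmul u (face W j ord0 v))).
  case: j v => [|j] v; first by rewrite !B0r !addr0.
  rewrite bdry_shift tmulDr linearD !BE !pre_bdryrS.
  by rewrite -d0_bdry.
have F2_id (M : lmodType 'F_2) (a b c d e f g h k : M) :
  a + (b + (c + d)) + (e + (f + g)) + (d + h + k) =
  a + e + (b + f + h) + (c + g + k) by F2_sum.
exact: F2_id.
Qed.

Lemma tswap_conj A i j n (V W : simplicial) (u : V i) (v : W j) :
  tswap (conj_family A i j n V W (tmul u v)) = A j i n W V (tmul v u).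
Proof. rewrite conjT_tmul; exact: tswapK. Qed.

Lemma tswap_commutator A i j n (V W : simplicial) (u : V i) (v : W j) :
  tswap (commutator (conj_family A) i j n V W (tmul u v)) =
  commutator A j i n W V (tmul v u).
Proof. rewrite commutator_conj; exact: tswapK. Qed.

(** For k even [commutator_step] applies directly. For k odd the recursion of D^{k+1} involves d
    instead of e, so the step is applied to the conjugates by T and conjugated back. *)
Lemma commutator_DkSS k i j n (V W : simplicial) (u : V i.+1) (v : W j.+1) :
  commutator (Dk k.+1) i.+1 j.+1 n.+1 V W (tmul u v) =
  Dk k.+1 i j.+1 n.+1 V W (tmul (face V i ord0 u) v)
  + Dk k.+1 i.+1 j n.+1 V W (tmul u (face W j ord0 v))
  + commutator (Dk k) i j n (shift V) (shift W)
      (tmul (u : shift V i) (v : shift W j))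
  + if odd k then commutator (Dk k) i j.+1 n.+1 V W (tmul (face V i ord0 u) v)
    else commutator (Dk k) i.+1 j n.+1 V W (tmul u (face W j ord0 v)).
Proof.
case: ifP => kodd; last first.
  apply: commutator_step.
  - exact: natural_Dk.
  - exact: Dk_0l.
  - exact: Dk_0l.
  - exact: Dk_0r.
  - by move=> {}i {}j {}n {}V {}W {}u {}v; rewrite DkSS kodd.
(* An odd k is positive, so D^k vanishes at j = 0 and its conjugate at i = 0, as the step
   requires. *)
case: k kodd => // k kodd.
rewrite -tswap_commutator.
rewrite (@commutator_step (conj_family (Dk k.+1))).
- rewrite 3!tswapD [X in X + _ + _]addrC.
  congr (_ + _ + _ + _).
  + exact: tswap_conj.
  + exact: tswap_conj.
  + exact: (@tswap_commutator _ _ _ _ (shift W) (shift V)).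
  + exact: tswap_commutator.
- by move=> *; apply/natural_conj/natural_Dk.
- by move=> j' n'; apply: conjT_eq0; apply: Dk_0r.
- by move=> j' n'; apply: conjT_eq0; apply: Dk_0r.
- by move=> j' n'; apply: conjT_eq0; apply: Dk_0l.
by move=> *; rewrite !conjT_tmul DkSS kodd linearD.
Qed.

(** The recursions of both conjugates are expanded. The induction hypothesis is used twice:
    suspended, and after one d_0 on the side fixed by the parity of k. *)
Lemma Dk_conj k n i j (V W : simplicial) (u : V i) (v : W j) :
  (n + k = i + j)%N -> (k <= n)%N ->
  Dk k i j n V W (tmul u v) + tswap (Dk k j i n W V (tmul v u)) =
  (if k is k'.+1 then commutator (Dk k') i j n V W (tmul u v)
   else EM i j n V W (tmul u v)) + phi k i j n V W (tmul u v).
Proof.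
elim: k n i j V W u v => [|k IH] n i j V W u v e kn.
  by apply: Dk0_conj; rewrite -e addn0.
case: n e kn => // n e kn; case: i j u v e => [|i] [|j] u v e.
- by rewrite addnS in e.
- rewrite Dk_0l Dk_0r linear0 phi_eq0 // !addr0 commutatorE Dk_0l linear0.
  by rewrite pre_bdryrS Dk_0l !addr0.
- rewrite Dk_0l Dk_0r linear0 phi_eq0 ?andbF // !addr0.
  (* For upper index 1 the right side is [D^0] at j = 0, and i + j >= 2 supplies the degree needed
     by [commutator_Dk0_S0]. *)
  case: k e kn {IH} => [|k] e kn.
    case: i u e => [|i] u e; first by lia.
    apply/esym/commutator_Dk0_S0; first by lia.
    by apply: commutator_EM; lia.
  by rewrite commutatorE Dk_0r linear0 pre_bdrylS Dk_0r !addr0.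
have eS : (n + k = i + j)%N by lia.
have IHS := IH n i j (shift V) (shift W) u v eS kn.
rewrite !DkSS linearD.
case: k e kn eS IH IHS => [|k] e kn eS IH IHS.
  rewrite commutator_Dk0_SS; [|lia|by apply: commutator_EM; lia].
  rewrite -phi_shift.
  have F2_id (M : lmodType 'F_2) (x y z t a b : M) : x + z = a + b ->
    x + y + (z + t) = y + t + a + b.
    move=> h; transitivity (x + z + (y + t)); first by F2_sum.
    by rewrite h; F2_sum.
  exact: F2_id IHS.
rewrite commutator_DkSS -phi_shift /=; case: (odd k) => /=.
  have := IH n.+1 i j.+1 V W (face V i ord0 u) v ltac:(lia) ltac:(lia).
  (* The total degree i + j + 1 = n + k + 2 exceeds 2(k + 1), so φ_{k+1} vanishes. *)
  rewrite phi_eq0; last by apply/negP => /andP[/eqP ei /eqP ej]; lia.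
  rewrite addr0 => <-.
  have F2_id (M : lmodType 'F_2) (x y z p q a b : M) : x + z = a + b ->
    x + y + (z + q) = p + y + a + (p + q) + b.
    move=> h; transitivity (x + z + (y + q)); first by F2_sum.
    by rewrite h; F2_sum.
  exact: F2_id IHS.
have := IH n.+1 i.+1 j V W u (face W j ord0 v) ltac:(lia) ltac:(lia).
rewrite phi_eq0; last by apply/negP => /andP[/eqP ei /eqP ej]; lia.
rewrite addr0 => <-.
have F2_id (M : lmodType 'F_2) (x y z p q a b : M) : x + z = a + b ->
  x + p + (z + q) = p + y + a + (y + q) + b.
  move=> h; transitivity (x + z + (p + q)); first by F2_sum.
  by rewrite h; F2_sum.
exact: F2_id IHS.
Qed.

Transparent commutator.

Theorem theorem2p9 (V W : simplicial) (i j k : nat) (hk : (2 * k <= i + j)%N)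
  (x : (V i ⊗ W j)%type) :
  let n := (i + j - k)%N in
  Dk k i j n V W x + conjT (Dk k j i n) V W x =
  match k with
  | 0 => EM i j n V W x + phi k i j n V W x
  | k'.+1 =>
      pre_bdry (fun i j => Dk k' i j n) i j V W x
      + post_bdry (Dk k' i j n.+1) V W x + phi k i j n V W x
  end.
Proof.
move=> n; have e : (n + k = i + j)%N by rewrite /n; lia.
have kn : (k <= n)%N by rewrite /n; lia.
move: n e kn => n e kn; rewrite {hk}.
have pure (u : V i) (v : W j) := Dk_conj u v e kn.
case: k e kn x pure => [|k] e kn x pure; move: x.
  apply: (@tensor_ext _ _ _ _ (tadd (Dk 0 i j n) (conjT (Dk 0 j i n)) V W)
    (tadd (EM i j n) (phi 0 i j n) V W)) => u v.
  by have := pure u v; rewrite -conjT_tmul.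
(* Both sides are recast as linear maps, equal once they agree on pure tensors; the two differential
   terms are [commutator] by conversion. *)
apply: (@tensor_ext _ _ _ _ (tadd (Dk k.+1 i j n) (conjT (Dk k.+1 j i n)) V W)
  (tadd (commutator (Dk k) i j n) (phi k.+1 i j n) V W)) => u v.
by have := pure u v; rewrite -conjT_tmul.
Qed.
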